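(* Let $r\in\mathbb Z$ and suppose $q_{0,1}=q_{1,2}$ and $q_{1,1}=q_{0,2}$. Then for all $n\in\mathbb N$ and all $j,k,\tilde j,\tilde k\in\mathbb Z$ with either ($j<r$ and $\tilde j<r$) or ($j>r$ and $\tilde j>r$), $$p^{\langle r\rangle}_{j,k}(2n\,|\,\tilde j,\tilde k)=p_{j,k}(2n\,|\,\tilde j,\tilde k)-p_{2r-j,\,j-r+k}(2n\,|\,\tilde j,\tilde k).$$
   Context: Fix $a>0$ and nonnegative numbers $q_{i,r}$ ($i=0,1$; $r=0,1,2$) with $\sum_{r=0}^2 q_{i,r}=1$ for $i=0,1$. The vertices of the hexagonal lattice are $\mathscr V_0\cup\mathscr V_1$, where $$\mathscr V_i=\left\{\left(\tfrac32 aj+ia,\ \tfrac{\sqrt3}{2}aj+\sqrt3 ak\right): j,k\in\mathbb Z\right\},\quad i=0,1.$$ $\{(X_n,Y_n):n\in\mathbb N_0\}$ is the time-homogeneous Markov chain on $\mathscr V_0\cup\mathscr V_1$ which, from a vertex $(x,y)\in\mathscr V_i$, moves in one step to $\left(x+a\cos(\tfrac{2\pi l}{3}+i\pi),\ y+a\sin(\tfrac{2\pi l}{3}+i\pi)\right)$ with probability $q_{i,l}$, $l=0,1,2$ (such a point belongs to $\mathscr V_{1-i}$). For $\tilde j,\tilde k\in\mathbb Z$, $\mathbb P_0$ denotes the probability conditional on the initial state $(X_0,Y_0)=\left(\tfrac32a\tilde j,\ \tfrac{\sqrt3}{2}a\tilde j+\sqrt3a\tilde k\right)\in\mathscr V_0$.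 With $i_n=\frac12(1-(-1)^n)$, for $n\in\mathbb N_0$ and $j,k\in\mathbb Z$ put $$p_{j,k}(n\,|\,\tilde j,\tilde k)=\mathbb P_0\left[(X_n,Y_n)=\left(\tfrac32aj+i_na,\ \tfrac{\sqrt3}{2}aj+\sqrt3ak\right)\right].$$ For $r\in\mathbb Z$ the boundary is $\mathcal B_r=\left\{\left(\tfrac32ar,\ \tfrac{\sqrt3}{2}ar+\sqrt3ak\right):k\in\mathbb Z\right\}$. For an initial state not in $\mathcal B_r$, the first-passage time is $T_r(\tilde j,\tilde k)=\min\{n\in\mathbb N:(X_n,Y_n)\in\mathcal B_r\}$ ($=\infty$ if there is no such $n$), and the taboo probability is $$p^{\langle r\rangle}_{j,k}(n\,|\,\tilde j,\tilde k)=\mathbb P_0\left[(X_n,Y_n)=\left(\tfrac32aj+i_na,\ \tfrac{\sqrt3}{2}aj+\sqrt3ak\right),\ T_r(\tilde j,\tilde k)>n\right].$$ *)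

(* Defs.v *)
From HB Require Import structures.
From mathcomp Require Import all_boot all_order all_algebra.
From mathcomp Require Import all_classical all_reals all_analysis.

Set Implicit Arguments.
Unset Strict Implicit.
Unset Printing Implicit Defensive.

Import Order.TTheory GRing.Theory Num.Theory.
Local Open Scope classical_set_scope.
Local Open Scope ring_scope.

Definition vertex (R : realType) (a c : R) (j k : int) : R * R :=
  (3 / 2 * a * j%:~R + c * a,
   Num.sqrt 3 / 2 * a * j%:~R + Num.sqrt 3 * a * k%:~R).

Definition vertices (R : realType) (a : R) (i : 'I_2) : set (R * R) :=
  [set v | exists j k : int, v = vertex a (i : nat)%:R j k].

Definition neighbour (R : realType) (a : R) (i : 'I_2) (l : 'I_3)
    (v : R * R) : R * R :=
  let theta := 2 * pi * (l : nat)%:R / 3 + (i : nat)%:R * pi in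
  (v.1 + a * cos theta, v.2 + a * sin theta).

(* The sublattice index at time [n] of a chain started in [vertices a 0]. *)
Definition parity (R : realType) (n : nat) : R := 2^-1 * (1 - (-1) ^+ n).

(* Equal to 0 when [B] is null. *)
Definition cond_prob d (Omega : measurableType d) (R : realType)
    (P : probability Omega R) (A B : set Omega) : R :=
  fine (P (A `&` B)) / fine (P B).

Section HexagonalWalk.
Context d (Omega : measurableType d) (R : realType) (P : probability Omega R).
Variables (a : R) (X Y : nat -> {RV P >-> R}).

Definition at_state (n : nat) (v : R * R) : set Omega :=
  [set w | (X n w, Y n w) = v].

Definition history (n : nat) (s : nat -> R * R) : set Omega :=
  [set w | forall m : nat, (m <= n)%N -> at_state m (s m) w].

(* Since the [q i l] sum to 1 over [l] and the three neighbours of a vertex are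
   distinct, the second clause determines all the one-step transition
   probabilities; the initial distribution is arbitrary. *)
Definition hexagonal_chain (q : 'I_2 -> 'I_3 -> R) : Prop :=
  (forall (n : nat) (w : Omega),
     (vertices a 0 `|` vertices a 1) (X n w, Y n w)) /\
  (forall (n : nat) (s : nat -> R * R) (i : 'I_2) (l : 'I_3),
     (0 < P (history n s))%E -> vertices a i (s n) ->
     cond_prob P (at_state n.+1 (neighbour a i l (s n))) (history n s) = q i l).

Definition start (j0 k0 : int) : set Omega := at_state 0 (vertex a 0 j0 k0).

Definition boundary (r : int) : set (R * R) :=
  [set v | exists k : int, v = vertex a 0 r k].

(* The minimum of a set of positive integers, +oo if the set is empty. *)
Definition first_passage (r : int) (w : Omega) : \bar R :=
  ereal_inf [set n%:R%:E | n in
    [set n : nat | (0 < n)%N /\ boundary r (X n w, Y n w)]].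

Definition state_prob (j k : int) (n : nat) (j0 k0 : int) : R :=
  cond_prob P (at_state n (vertex a (parity R n) j k)) (start j0 k0).

Definition taboo_prob (r j k : int) (n : nat) (j0 k0 : int) : R :=
  cond_prob P
    (at_state n (vertex a (parity R n) j k) `&`
     [set w | (n%:R%:E < first_passage r w)%E])
    (start j0 k0).

End HexagonalWalk.

(* Main.v *)
Require Import Defs.
From HB Require Import structures.
From mathcomp Require Import all_boot all_order all_algebra.
From mathcomp Require Import all_classical all_reals all_analysis.
From mathcomp Require Import zify ring lra.

Import Order.TTheory GRing.Theory Num.Theory.
Local Open Scope classical_set_scope.
Local Open Scope ring_scope.

(* The square of the chain is a random walk on the first sublattice whose step
   law is invariant under the reflection in the boundary line: the hypotheses on
   [q] say that the reflection exchanges the two half steps.  Since one double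
   step changes the abscissa by at most one unit, the line cannot be jumped
   over, and the reflection principle follows by induction on the number of
   double steps. *)

(** * Reflection principle for the two-step walk in integer coordinates *)

Section Reflection.
Variables (R : realType) (q : 'I_2 -> 'I_3 -> R).

(* The vertex with coordinates [p] in [vertices a 0] has the neighbours with
   coordinates [p + edge l] in [vertices a 1], and the vertex with coordinates
   [p] in [vertices a 1] has the neighbours [p - edge l] in [vertices a 0]. *)
Definition edge (l : 'I_3) : int * int :=
  nth 0 [:: (0, 0); (-1, 1); (-1, 0)] l.

(* The probability of being at [t] after [2 * n] steps from [p], both in
   [vertices a 0], without meeting [D] at the times [2, 4, ..., 2 * n]. *)
Fixpoint walk (D : pred (int * int)) (t : int * int) (n : nat)
    (p : int * int) : R :=
  if n is n'.+1 then
    \sum_(l < 3) \sum_(l' < 3) q 0 l * q 1 l' *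
      (if D (p + edge l - edge l') then 0
       else walk D t n' (p + edge l - edge l'))
  else (p == t)%:R.

(** In the plane this is the mirror reflection of the first sublattice in the vertical line through
    the column [r]. The axes of the coordinates are oblique, so the second one must shift to keep
    the ordinate. *)
Definition reflect (r : int) (p : int * int) : int * int :=
  (2 * r - p.1, p.1 - r + p.2).

Lemma reflectK (r : int) : involutive (reflect r).
Proof. by case=> x y; rewrite /reflect /=; congr (_, _); lia. Qed.

Lemma reflect_id (r : int) (p : int * int) : p.1 = r -> reflect r p = p.
Proof. by case: p => x y /= <-; rewrite /reflect /=; congr (_, _); lia. Qed.

(* The reflection maps [edge l] to [- edge (- l)], where [- l] swaps the
   directions 1 and 2, so it exchanges the roles of the two half steps. *)
Lemma reflect_step (r : int) (p : int * int) (l l' : 'I_3) :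
  reflect r (p + edge l - edge l') = reflect r p + edge (- l') - edge (- l).
Proof.
case: p => x y.
by case: l => -[|[|[|//]]] ?; case: l' => -[|[|[|//]]] ?;
  rewrite /reflect /edge /=; apply: injective_projections => /=; lia.
Qed.

Lemma edge_bound (p : int * int) (l l' : 'I_3) :
  p.1 - 1 <= (p + edge l - edge l').1 <= p.1 + 1.
Proof.
case: p => x y.
by case: l => -[|[|[|//]]] ?; case: l' => -[|[|[|//]]] ?;
  rewrite /edge /=; lia.
Qed.

Hypothesis q_sym : forall l, q 1 l = q 0 (- l).

(** Exchanging the two sums and negating both directions turns each step from [reflect r p] into the
    mirror image of a step from [p]; [q_sym] matches the weights. *)
Lemma walk_reflect (r : int) (t : int * int) (n : nat) (p : int * int) :
  walk pred0 (reflect r t) n (reflect r p) = walk pred0 t n p.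
Proof.
elim: n p => [|n IHn] p /=; first by rewrite (can_eq (reflectK r)).
rewrite exchange_big /= (reindex_inj oppr_inj) /=.
apply: eq_bigr => l _; rewrite (reindex_inj oppr_inj) /=.
apply: eq_bigr => l' _.
by rewrite -reflect_step IHn !q_sym opprK [q 0 l * _]mulrC.
Qed.

(* As a function of [p], the right-hand side is antisymmetric under the
   reflection, hence zero on the line, where the taboo walk is killed. *)
Lemma reflection_principle (r : int) (t : int * int) (n : nat)
    (p : int * int) :
  (p.1 < r /\ t.1 < r) \/ (r < p.1 /\ r < t.1) ->
  walk [pred v | v.1 == r] t n p =
    walk pred0 t n p - walk pred0 (reflect r t) n p.
Proof.
elim: n p => [|n IHn] p pt /=.
  (* The mirror image of [t] lies across the line from [p], so the second term vanishes at time
     0. *)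
  case: (p =P reflect r t) => [pE|_]; last by rewrite subr0.
  by case: t p pE pt => x y [x' y'] [-> _] /= pt; exfalso; lia.
rewrite -sumrB; apply: eq_bigr => l _; rewrite -sumrB; apply: eq_bigr => l' _.
rewrite -mulrBr; congr (_ * _).
have /= p'_bound := edge_bound p l l'.
case: eqP => [p'r|p'r]; last by apply: IHn => /=; lia.
by rewrite -{2}(reflect_id r (p + edge l - edge l')) // walk_reflect subrr.
Qed.

End Reflection.

(** * Geometry of the hexagonal lattice *)

Section Lattice.
Variables (R : realType) (a : R).
Hypothesis a_gt0 : 0 < a.

(** The triple-angle formula at [pi] reads [4 * c ^+ 3 - 3 * c + 1 = 0], which factors as
    [(c + 1) * (2 * c - 1) ^+ 2 = 0]; positivity of [c] excludes the root [-1]. *)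
Lemma cos_pi3 : cos (pi / 3) = 2^-1 :> R.
Proof.
set c := cos (pi / 3).
have c_gt0 : 0 < c by apply: cos_gt0_pihalf; have := pi_gt0 R; lra.
have : cos (pi / 3 + (pi / 3 + pi / 3)) = -1 :> R.
  by rewrite -[RHS](cospi R); congr cos; field.
rewrite cosD cosD sinD -/c; set s := sin _.
have := cos2Dsin2 (pi / 3 : R); rewrite -/c -/s => cs c3.
have : (c + 1) * (2 * c - 1) ^+ 2 = 0.
  have -> : (c + 1) * (2 * c - 1) ^+ 2 =
    c * (c * c - s * s) - s * (s * c + c * s) + 1
    + 3 * c * (c ^+ 2 + s ^+ 2 - 1) by ring.
  by rewrite cs c3; ring.
by move=> /eqP; rewrite mulf_eq0 sqrf_eq0 => /orP[] /eqP ?; lra.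
Qed.

Lemma sin_pi3 : sin (pi / 3) = Num.sqrt 3 / 2 :> R.
Proof.
have s_gt0 : 0 < sin (pi / 3) :> R.
  by apply: sin_gt0_pi; have := pi_gt0 R; lra.
apply: (@pexpIrn _ 2) => //.
- by rewrite nnegrE ltW.
- by rewrite nnegrE divr_ge0 ?sqrtr_ge0.
have := cos2Dsin2 (pi / 3 : R); rewrite cos_pi3 expr_div_n sqr_sqrtr //; lra.
Qed.

Lemma vertex_inj (p p' : int * int) (c : R) :
  vertex a c p.1 p.2 = vertex a c p'.1 p'.2 -> p = p'.
Proof.
have s_gt0 : 0 < Num.sqrt 3 :> R by rewrite sqrtr_gt0.
case: p p' => x y [x' y'] [/= xE yE].
have xx' : x = x'.
  apply/eqP; rewrite -(eqr_int R); apply/eqP.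
  by apply: (mulfI (lt0r_neq0 a_gt0)); lra.
subst x'; congr (_, _).
apply/eqP; rewrite -(eqr_int R); apply/eqP.
apply: (mulfI (lt0r_neq0 (mulr_gt0 s_gt0 a_gt0))); lra.
Qed.

Lemma vertex_boundary (r j k : int) :
  boundary a r (vertex a 0 j k) <-> j = r.
Proof.
split=> [[k' /(vertex_inj (j, k) (r, k')) []]//|->]; by exists k.
Qed.

(** In units of [a / 2] the abscissae are [3 * j + 2] and [3 * j'], which differ modulo 3. *)
Lemma vertex1_neq0 (j k j' k' : int) :
  vertex a 1 j k <> vertex a 0 j' k'.
Proof.
case=> xE _.
have /eqP : (3 * j + 2)%:~R = (3 * j')%:~R :> R.
  rewrite intrD !intrM; apply: (mulfI (lt0r_neq0 a_gt0)); lra.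
by rewrite eqr_int => /eqP; lia.
Qed.

Lemma neighbour0 (l : 'I_3) (p : int * int) :
  neighbour a 0 l (vertex a 0 p.1 p.2)
    = vertex a 1 (p + edge l).1 (p + edge l).2.
Proof.
have cs2 : (cos (pi - pi / 3) = - 2^-1 :> R) *
    (sin (pi - pi / 3) = Num.sqrt 3 / 2 :> R).
  by rewrite ![pi - _]addrC cosDpi sinDpi cosN sinN opprK cos_pi3 sin_pi3.
have cs4 : (cos (pi / 3 + pi) = - 2^-1 :> R) *
    (sin (pi / 3 + pi) = - (Num.sqrt 3 / 2) :> R).
  by rewrite cosDpi sinDpi cos_pi3 sin_pi3.
case: p => x y; rewrite /neighbour /vertex /edge /= mulr0n !mul0r !addr0.
case: l => -[|[|[|//]]] ? /=.
- by rewrite mulr0n mulr0 mul0r cos0 sin0 !intrD; congr (_, _); field.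
- rewrite (_ : 2 * pi * _ / 3 = pi - pi / 3); last by field.
  by rewrite !cs2 !intrD; congr (_, _); field.
- rewrite (_ : 2 * pi * _ / 3 = pi / 3 + pi); last by field.
  by rewrite !cs4 !intrD; congr (_, _); field.
Qed.

(** The extra angle [pi] negates the displacement computed in [neighbour0]. *)
Lemma neighbour1 (l : 'I_3) (p : int * int) :
  neighbour a 1 l (vertex a 1 p.1 p.2)
    = vertex a 0 (p - edge l).1 (p - edge l).2.
Proof.
have := neighbour0 l p; case: p => x y.
rewrite /neighbour /vertex /= mulr0n mulr1n !mul0r !addr0 !mul1r cosDpi sinDpi.
set c := cos _; set s := sin _; rewrite !intrD !intrN => -[xE yE].
congr (_, _); lra.
Qed.

Lemma edge_inj : injective edge.
Proof.
by case=> -[|[|[|//]]] ? [] [|[|[|//]]] ? //= _; apply: val_inj.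
Qed.

Lemma neighbour_inj (i : 'I_2) (p : R * R) :
  vertices a i p -> injective (fun l => neighbour a i l p).
Proof.
case: i => -[|[|//]] ? /= [j [k ->]] l l'.
  rewrite [LHS](neighbour0 l (j, k)) [RHS](neighbour0 l' (j, k)).
  by move/vertex_inj => /addrI /edge_inj.
rewrite [LHS](neighbour1 l (j, k)) [RHS](neighbour1 l' (j, k)).
by move/vertex_inj => /addrI /oppr_inj /edge_inj.
Qed.

End Lattice.

(** * From the Markov chain to sums over paths *)

Section Chain.
Variables (d : measure_display) (Omega : measurableType d) (R : realType).
Variables (P : probability Omega R) (a : R) (q : 'I_2 -> 'I_3 -> R).
Variables (X Y : nat -> {RV P >-> R}).
Hypothesis a_gt0 : 0 < a.
Hypothesis q_sum1 : forall i, \sum_(l < 3) q i l = 1.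
Hypothesis chainXY : hexagonal_chain a X Y q.

Let pr (A : set Omega) : R := fine (P A).

Lemma measurable_at_state (n : nat) (v : R * R) : measurable (at_state X Y n v).
Proof.
have -> : at_state X Y n v = X n @^-1` [set v.1] `&` Y n @^-1` [set v.2].
  apply/seteqP; split=> w; first by rewrite /at_state /= => <-.
  by case: v => v1 v2 [/= <- <-].
by apply: measurableI; exact: measurable_funPTI.
Qed.

Lemma history0 (s : nat -> R * R) :
  history X Y 0 s = at_state X Y 0 (s 0%N).
Proof.
apply/seteqP; split=> w; first by move/(_ 0%N); apply.
by move=> ? [|m].
Qed.

Definition extend (n : nat) (s : nat -> R * R) (v : R * R) (m : nat) : R * R :=
  if (m <= n)%N then s m else v.

Lemma history_extend (n : nat) (s : nat -> R * R) (v : R * R) :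
  history X Y n.+1 (extend n s v) =
    history X Y n s `&` at_state X Y n.+1 v.
Proof.
apply/seteqP; split=> w.
  move=> h; split; last by have := h n.+1 (leqnn _); rewrite /extend ltnn.
  by move=> m mn; have := h m (leqW mn); rewrite /extend mn.
move=> [h hv] m; rewrite leq_eqVlt ltnS => /predU1P[->|mn]; rewrite /extend.
  by rewrite ltnn.
by rewrite mn; exact: h.
Qed.

Lemma measurable_history (n : nat) (s : nat -> R * R) :
  measurable (history X Y n s).
Proof.
have -> : history X Y n s =
    \bigcap_(m in [set m | (m <= n)%N]) at_state X Y m (s m) by [].
apply: bigcap_measurable => [|m _]; first by exists 0%N.
exact: measurable_at_state.
Qed.

(** The transition law speaks only of histories of positive probability; for a null history both
    sides are 0. *)
Lemma pr_history_extend (n : nat) (s : nat -> R * R) (i : 'I_2) (l : 'I_3) :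
  vertices a i (s n) ->
  pr (history X Y n.+1 (extend n s (neighbour a i l (s n)))) =
    pr (history X Y n s) * q i l.
Proof.
move=> sn; rewrite history_extend setIC.
have mh := measurable_history n s.
have := measure_ge0 P (history X Y n s); rewrite le_eqVlt => /predU1P[h0|h_gt0].
  rewrite /pr -h0 mul0r (@subset_measure0 _ _ _ P _ (history X Y n s)) //.
  by apply: measurableI => //; exact: measurable_at_state.
have [_ /(_ n s i l h_gt0 sn) <-] := chainXY.
rewrite /cond_prob /pr mulrC divfK // fine_eq0 ?fin_num_measure //.
by rewrite gt_eqF.
Qed.

(* The three neighbours carry the full conditional probability, so moving
   elsewhere is a null event. *)
Lemma pr_history_split (n : nat) (s : nat -> R * R) (i : 'I_2)
    (A : set Omega) :
  measurable A -> vertices a i (s n) ->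
  pr (history X Y n s `&` A) = \sum_(l < 3)
    pr (history X Y n.+1 (extend n s (neighbour a i l (s n))) `&` A).
Proof.
move=> mA sn; pose U l := at_state X Y n.+1 (neighbour a i l (s n)).
have mU l : measurable (U l) by exact: measurable_at_state.
have mH := measurable_history n s.
have mbU : measurable (\big[setU/set0]_(l < 3) U l) by exact: bigsetU_measurable.
have prU B : measurable B ->
    P (B `&` \big[setU/set0]_(l < 3) U l) = (\sum_(l < 3) P (B `&` U l))%E.
  move=> mB; rewrite big_distrr /= measure_bigsetU_ord //.
    by move=> l; exact: measurableI.
  apply: sub_trivIset (@subsetT _ _) _ => l l' _ _ [w [[_ wl] [_ wl']]].
  by apply: (neighbour_inj R a a_gt0 i (s n) sn); rewrite -[LHS]wl.
have mHA := measurableI _ _ mH mA.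
have H0 : P (history X Y n s `\` \big[setU/set0]_(l < 3) U l) = 0%E.
  rewrite measureD // ?ltey_eq ?fin_num_measure // [X in (_ - X)%E](prU _ mH).
  have <- : P (history X Y n s) = (\sum_(l < 3) P (history X Y n s `&` U l))%E.
    rewrite -[LHS]fineK ?fin_num_measure // -[fine _]mulr1 -(q_sum1 i) mulr_sumr.
    rewrite -sumEFin; apply: eq_bigr => l _; rewrite -pr_history_extend //.
    rewrite history_extend fineK // fin_num_measure //.
    exact: measurableI _ _ mH (mU l).
  by rewrite subee // fin_num_measure.
have -> : pr (history X Y n s `&` A) =
    pr (history X Y n s `&` A `&` \big[setU/set0]_(l < 3) U l).
  rewrite /pr (measureDI P mHA mbU) (@subset_measure0 _ _ _ P _
    (history X Y n s `\` \big[setU/set0]_(l < 3) U l)) ?add0e //.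
  - exact: measurableD.
  - exact: measurableD.
  - by apply: setSD; exact: subIsetl.
rewrite /pr prU // -sum_fine; last first.
  by move=> l _; rewrite fin_num_measure //; exact: measurableI.
by apply: eq_bigr => l _; rewrite history_extend setIAC.
Qed.

(** An arbitrary killing set [C] treats both walks at once: it is the boundary line for the taboo
    walk and empty for the free one. *)
Variables (C : set (R * R)) (D : pred (int * int)).
Hypothesis CD : forall p : int * int, C (vertex a 0 p.1 p.2) <-> D p.
Hypothesis C1 : forall p : int * int, ~ C (vertex a 1 p.1 p.2).

Definition reach (n : nat) (t : int * int) : set Omega :=
  at_state X Y n (vertex a 0 t.1 t.2) `&`
  [set w | forall m, (0 < m <= n)%N -> ~ C (X m w, Y m w)].

(** Induction on the number [m] of remaining double steps: splitting twice over the neighbours moves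
    one double step into the history, hence the quantification over [s] and [n]. *)
Lemma pr_history_reach (t : int * int) (m n : nat) (s : nat -> R * R)
    (p : int * int) :
  measurable (reach (2 * (n + m)) t) ->
  s (2 * n)%N = vertex a 0 p.1 p.2 ->
  (forall k, (0 < k <= 2 * n)%N -> ~ C (s k)) ->
  pr (history X Y (2 * n) s `&` reach (2 * (n + m)) t) =
    pr (history X Y (2 * n) s) * walk R q D t m p.
Proof.
elim: m n s p => [|m IHm] n s p mr sn sC.
  rewrite addn0 /=; case: eqP => [pt|pt].
    rewrite mulr1; congr pr; apply: setIidl => w h; split.
      by rewrite /= -pt -sn; exact: h.
    by move=> k /andP[k0 kn]; rewrite (h k kn); apply: sC; rewrite k0.
  rewrite mulr0 /pr (_ : _ `&` _ = set0) ?measure0 //.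
  apply/seteqP; split=> w //= [h [wt _]]; apply: pt.
  by apply: (vertex_inj R a a_gt0 _ _ 0); rewrite -sn -wt; exact/esym/h.
have sn0 : vertices a 0 (s (2 * n)%N) by exists p.1, p.2; rewrite sn.
rewrite (pr_history_split _ _ _ _ mr sn0) mulr_sumr; apply: eq_bigr => l _.
set s1 := extend _ _ _.
have s1E : s1 (2 * n).+1 = vertex a 1 (p + edge l).1 (p + edge l).2.
  by rewrite /s1 /extend ltnn sn neighbour0.
have sn1 : vertices a 1 (s1 (2 * n).+1).
  by exists (p + edge l).1, (p + edge l).2; rewrite s1E.
rewrite (pr_history_split _ _ _ _ mr sn1) mulr_sumr; apply: eq_bigr => l' _.
set p2 := p + edge l - edge l'.
set s2 := extend _ _ _.
have s2E : s2 (2 * n.+1)%N = vertex a 0 p2.1 p2.2.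
  by rewrite mulnS /s2 /extend ltnn s1E neighbour1.
have -> (c : R) : pr (history X Y (2 * n) s) * (q 0 l * q 1 l' * c) =
    pr (history X Y (2 * n.+1) s2) * c.
  by rewrite mulnS !pr_history_extend // !mulrA.
have -> : (2 * n).+2 = (2 * n.+1)%N by rewrite mulnS.
(* A history ending in [C] is incompatible with [reach]; this is where the walk is killed. *)
case: ifPn => [Dp2|nDp2].
  rewrite mulr0 /pr (_ : _ `&` _ = set0) ?measure0 //.
  apply/seteqP; split=> w //= [h [_ /(_ (2 * n.+1)%N)]]; apply.
    lia.
  by rewrite (h _ (leqnn _)) s2E; apply/CD.
rewrite addnS -addSn; apply: IHm => //; first by rewrite addSn -addnS.
(* Two new times must avoid [C]: the even one since [D p2] fails, the odd one by [C1]. *)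
move=> k; rewrite mulnS => /andP[k0]; rewrite leq_eqVlt => /predU1P[->|].
  by rewrite -mulnS s2E => /CD; apply/negP.
rewrite ltnS /s2 /extend => k1; rewrite k1 /s1 /extend; case: ifPn => [kn|_].
  by apply: sC; rewrite k0.
by rewrite sn neighbour0; exact: C1.
Qed.

Lemma measurable_avoid (N : nat) :
  measurable C ->
  measurable [set w | forall m, (0 < m <= N)%N -> ~ C (X m w, Y m w)].
Proof.
move=> mC.
have -> : [set w | forall m, (0 < m <= N)%N -> ~ C (X m w, Y m w)] =
    \bigcap_m (if (0 < m <= N)%N then
      ~` ((fun w => (X m w, Y m w)) @^-1` C) else setT).
  apply/seteqP; split=> w h m => [_|mN]; last by have := h m I; rewrite mN.
  by case: ifPn => // mN; exact: h.
apply: bigcap_measurable => [|m _]; first by exists 0%N.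
case: ifP => // _; apply: measurableC; rewrite -[X in measurable X]setTI.
by apply: (measurable_fun_pair (measurable_funPT (X m))
  (measurable_funPT (Y m))).
Qed.

Lemma cond_prob_reach (t : int * int) (n : nat) (j0 k0 : int) :
  measurable C -> (0 < P (start a X Y j0 k0))%E ->
  cond_prob P (reach (2 * n) t) (start a X Y j0 k0) =
    walk R q D t n (j0, k0).
Proof.
(* The starting event is the history of length 0, which reads only the value of [s] at 0. *)
move=> mC start_gt0; pose s (_ : nat) := vertex a 0 j0 k0.
have startE : start a X Y j0 k0 = history X Y (2 * 0) s.
  by rewrite muln0 history0.
have mr : measurable (reach (2 * (0 + n)) t).
  apply: measurableI; [exact: measurable_at_state|exact: measurable_avoid].
rewrite /cond_prob setIC startE -[X in reach (2 * X)]add0n.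
have := pr_history_reach t n 0 s (j0, k0) mr erefl; rewrite /pr => ->.
  rewrite mulrAC divff ?mul1r // fine_eq0 -?startE ?gt_eqF //.
  by rewrite fin_num_measure //; exact: measurable_at_state.
by case.
Qed.

End Chain.

(** * Boundary events and the taboo formula *)

Lemma measurable_boundary (R : realType) (a : R) (r : int) :
  measurable (boundary a r).
Proof.
have -> : boundary a r = \bigcup_(k in [set: int]) [set vertex a 0 r k].
  by apply/seteqP; split=> v [k]; [exists k | move=> _ ->; exists k].
apply: countable_bigcupT_measurable => [|k]; first exact: countableP.
have -> : [set vertex a 0 r k] =
    [set (vertex a 0 r k).1] `*` [set (vertex a 0 r k).2].
  by apply/seteqP; split=> -[x y] /= => -[-> ->].
by apply: measurableX; exact: measurable_set1.
Qed.

Lemma first_passage_gt (d : measure_display) (Omega : measurableType d)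
    (R : realType) (P : probability Omega R) (a : R)
    (X Y : nat -> {RV P >-> R}) (r : int) (N : nat) (w : Omega) :
  (N%:R%:E < first_passage a X Y r w)%E <->
  forall m, (0 < m <= N)%N -> ~ boundary a r (X m w, Y m w).
Proof.
split=> [N_lt m /andP[m_gt0 mN] mB|h].
  have : (first_passage a X Y r w <= m%:R%:E)%E.
    by apply: ereal_inf_lbound; exists m.
  by move=> /(lt_le_trans N_lt); rewrite lte_fin ltr_nat ltnNge mN.
(* Passage times are integers, so [N.+1] is a lower bound, which keeps the inequality for the
   infimum strict. *)
apply: (@lt_le_trans _ _ N.+1%:R%:E); first by rewrite lte_fin ltr_nat.
apply: le_ereal_inf_tmp => _ [m [m_gt0 mB] <-].
rewrite lee_fin ler_nat ltnNge; apply/negP => mN.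
by apply: (h m) => //; rewrite m_gt0.
Qed.

Theorem theorem5p1 (R : realType) (d : measure_display)
    (Omega : measurableType d) (P : probability Omega R)
    (a : R) (q : 'I_2 -> 'I_3 -> R) (X Y : nat -> {RV P >-> R})
    (a_gt0 : 0 < a)
    (q_ge0 : forall (i : 'I_2) (l : 'I_3), 0 <= q i l)
    (q_sum1 : forall i : 'I_2, \sum_(l < 3) q i l = 1)
    (chainXY : hexagonal_chain a X Y q)
    (r : int)
    (q01_q12 : q 0 1 = q 1 2)
    (q11_q02 : q 1 1 = q 0 2)
    (n : nat) (n_gt0 : (0 < n)%N)
    (j k j0 k0 : int)
    (same_side : (j < r /\ j0 < r) \/ (r < j /\ r < j0))
    (start_gt0 : (0 < P (start a X Y j0 k0))%E) :
  taboo_prob a X Y r j k (2 * n)%N j0 k0 =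
    state_prob a X Y j k (2 * n)%N j0 k0
    - state_prob a X Y (2 * r - j) (j - r + k) (2 * n)%N j0 k0.
Proof.
(* Negation is modulo 3. Directions 1 and 2 are the hypotheses; direction 0 follows since both laws
   have total mass 1. *)
have q_sym l : q 1 l = q 0 (- l).
  have I3 : [/\ 0 = ord0 :> 'I_3, 1 = lift ord0 ord0 :> 'I_3
      & 2 = lift ord0 (lift ord0 ord0) :> 'I_3] by split; apply: val_inj.
  have := q_sum1 0; have := q_sum1 1; rewrite !big_ord_recl !big_ord0 !addr0.
  have [<- <- <-] := I3; rewrite q11_q02 -q01_q12 => q1 q0.
  case: l => -[|[|[|//]]] l3.
  - have [-> ->] : Ordinal l3 = 0 /\ - Ordinal l3 = 0 by split; apply: val_inj.
    lra.
  - have [-> ->] : Ordinal l3 = 1 /\ - Ordinal l3 = 2 by split; apply: val_inj.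
    by [].
  - have [-> ->] : Ordinal l3 = 2 /\ - Ordinal l3 = 1 by split; apply: val_inj.
    by [].
have parity2n : parity R (2 * n) = 0.
  by rewrite /parity exprM sqrrN expr1n expr1n subrr mulr0.
have state_walk (t : int * int) :
    state_prob a X Y t.1 t.2 (2 * n) j0 k0 = walk R q pred0 t n (j0, k0).
  rewrite -(@cond_prob_reach _ _ _ P a q X Y _ _ _ set0) //; last by move=> p [].
  rewrite /state_prob parity2n /reach; congr cond_prob.
  by apply/seteqP; split=> w; [move=> wt; split=> // m _ []|case].
have -> : taboo_prob a X Y r j k (2 * n) j0 k0
    = walk R q [pred v | v.1 == r] (j, k) n (j0, k0).
  rewrite -(@cond_prob_reach _ _ _ P a q X Y _ _ _ (boundary a r)) //.
  - rewrite /taboo_prob parity2n /reach; congr (cond_prob _ (_ `&` _)).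
    by apply/seteqP; split=> w /first_passage_gt.
  - move=> p /=; split=> [/(vertex_boundary _ _ a_gt0)/eqP //|].
    by move=> /eqP/(vertex_boundary _ _ a_gt0).
  - by move=> p [k' /(vertex1_neq0 _ _ a_gt0)].
  - exact: measurable_boundary.
rewrite (state_walk (j, k)) (state_walk (reflect r (j, k))).
apply: reflection_principle => //=.
by case: same_side => -[jr j0r]; [left|right].
Qed.
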